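(* Let $\ell \geq 3$ be an integer. Every Steiner triple system of order $v$ with \[ v \geq \frac{(\ell-1)(\ell^5 - 9\ell^3 + 20\ell^2 - 36\ell + 16)}{16} \] has an $\ell$-good sequencing.
   Context: A Steiner triple system of order $v$ (an STS$(v)$) is a pair $(X,\mathcal{B})$ where $X$ is a set of $v$ points and $\mathcal{B}$ is a set of 3-subsets of $X$ (blocks) such that every pair of distinct points lies in exactly one block. For an integer $\ell \geq 3$, an $\ell$-good sequencing of $(X,\mathcal{B})$ is a permutation $[x_1\, x_2\, \cdots\, x_v]$ of $X$ such that no $\ell$ consecutive points $x_j, x_{j+1},\dots,x_{j+\ell-1}$ of the permutation contain a block of $\mathcal{B}$. *)

(* Defs.v *)
From mathcomp Require Import all_boot all_order all_algebra.

Set Implicit Arguments.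
Unset Strict Implicit.
Unset Printing Implicit Defensive.

(* The point set X is the whole finite type T. *)
Definition steiner_triple_system (v : nat) (T : finType) (B : {set {set T}}) :
    Prop :=
  [/\ #|T| = v,
      forall b : {set T}, b \in B -> #|b| = 3
    & forall x y : T, x != y ->
        exists! b : {set T}, [/\ b \in B, x \in b & y \in b]].

(* The l consecutive entries of s starting at index j (indices from 0);
   exactly l of them as soon as j + l <= size s. *)
Definition window (T : Type) (l j : nat) (s : seq T) : seq T :=
  take l (drop j s).

Definition good_sequencing (l : nat) (T : finType) (B : {set {set T}})
    (s : seq T) : Prop :=
  perm_eq s (enum T) /\
  forall j : nat, j + l <= size s ->
    forall b : {set T}, b \in B -> ~~ (b \subset window l j s).

(* Main.v *)
(* Appending points greedily, a new point only has to avoid the third points of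
   the blocks through two of the last l - 1 points, so the process can continue
   while more than m = C(l-1, 2) points are missing.  To place the last m points,
   prepare the beginning: start with a greedy sequence W0 of m (l - 1) points and
   then append every third point of a pair at distance at most l - 2 in W0.  (Any
   given x can be reached after l - 2 fillers chosen not to lie in a block with
   x and a nearby point.)  Continue greedily until exactly m points are left.
   None of these lies in a block with a close pair of W0, so one of them can be
   inserted before each of the m consecutive runs of l - 1 points of W0: a window
   contains at most one inserted point, and insertions only
   increase the distances between the other points. *)
Require Import Defs.
From mathcomp Require Import all_boot all_order all_algebra.
From mathcomp Require Import zify lra.

Set Implicit Arguments.
Unset Strict Implicit.
Unset Printing Implicit Defensive.

Import Order.TTheory GRing.Theory Num.Theory.

(** * Third points of blocks and partial sequences *)

Lemma exists_notin (T : finType) (L : seq T) :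
  size L < #|T| -> exists y, y \notin L.
Proof.
move=> hL; case: (pickP (fun y => y \notin L)) => [y hy|h]; first by exists y.
have : #|T| <= #|L| by apply: subset_leq_card; apply/subsetP => y _; move: (h y) => /negbFE.
by move=> /leq_trans/(_ (card_size L)); rewrite leqNgt hL.
Qed.

(* In a Steiner triple system the default [x] is only reached when [x = y]. *)
Definition third (T : finType) (B : {set {set T}}) (x y : T) : T :=
  odflt x [pick z | [&& z != x, z != y & [set x; y; z] \in B]].

Lemma thirdP (v : nat) (T : finType) (B : {set {set T}}) (x y z : T) :
  steiner_triple_system v B -> x != y -> z != x -> z != y ->
  [set x; y; z] \in B -> third B x y = z.
Proof.
move=> [_ _ hB] xy zx zy hz; rewrite /third; case: pickP => [z' /and3P[z'x z'y hz']|/(_ z)]; last first.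
  by rewrite zx zy hz.
have [b [_ hu]] := hB x y xy.
have e : [set x; y; z] = [set x; y; z'].
  by rewrite -(hu [set x; y; z]) ?(hu [set x; y; z']) //; split=> //; rewrite !inE eqxx ?orbT.
have : z' \in [set x; y; z] by rewrite e !inE eqxx ?orbT.
by rewrite !inE (negPf z'x) (negPf z'y) => /eqP.
Qed.

(** Unlike [good_sequencing], this makes sense for unfinished sequences and so serves as an
    invariant. Increasing positions reduce appending a point to a condition on pairs. *)
Definition spread (l : nat) (T : finType) (B : {set {set T}}) (x0 : T) (s : seq T) :=
  forall i j k, i < j -> j < k -> k < size s -> k < i + l ->
    [set nth x0 s i; nth x0 s j; nth x0 s k] \notin B.

(** * Greedy extension *)

Section Build.
Context (l v : nat) (T : finType) (B : {set {set T}}) (x0 : T).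
Hypotheses (hl : 3 <= l) (hB : steiner_triple_system v B).
Local Notation spread := (spread l B x0).
Local Notation m := 'C(l.-1, 2).

Lemma card_points : #|T| = v. Proof. by case: hB. Qed.

Lemma spread_rcons (s : seq T) (y : T) :
  spread s ->
  (forall i j, i < j -> j < size s -> size s < i + l ->
     [set nth x0 s i; nth x0 s j; y] \notin B) ->
  spread (rcons s y).
Proof.
move=> hs hy i j k ij jk; rewrite size_rcons ltnS leq_eqVlt => /orP[/eqP ek|ks] kl.
  rewrite !nth_rcons ek ltnn eqxx ifT ?ifT; try lia.
  by apply: hy; lia.
rewrite !nth_rcons ks ifT ?ifT; try lia.
exact: hs.
Qed.

(** The entries of [s], the third points of pairs among its last $l-1$ entries, and [L] cannot
    exhaust the points. [L] leaves room for extra prohibitions. *)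
Lemma extend_avoiding (s L : seq T) :
  uniq s -> spread s -> size s + m + size L < v ->
  exists y, [/\ y \notin L, uniq (rcons s y) & spread (rcons s y)].
Proof.
move=> us hs hsz.
(* Counted from the end of [s]. If [s] is short, truncated subtraction repeats index 0, which only
   adds prohibitions. *)
pose back i := nth x0 s (size s - i.+1).
pose P := [seq third B (back i) (back j) | i <- iota 0 l.-1, j <- iota 0 i].
have sP : size P = m.
  rewrite size_allpairs_dep sumnE big_map.
  rewrite (eq_bigr (fun i => i)); last by move=> i _; rewrite size_iota.
  by rewrite -bin2_sum /index_iota subn0.
have [|y] := @exists_notin T (s ++ P ++ L).
  by rewrite card_points !size_cat sP; lia.
rewrite !mem_cat !negb_or => /and3P[ys yP yL]; exists y; split=> //.
  by rewrite rcons_uniq ys.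
apply: spread_rcons => // i j ij js il; apply: contra yP => hb.
have iS : i < size s := ltn_trans ij js.
have -> : y = third B (nth x0 s i) (nth x0 s j).
  apply/esym/(thirdP hB) => //.
  - by rewrite nth_uniq // (ltn_eqF ij).
  - by apply: contraNneq ys => ->; apply: mem_nth.
  - by apply: contraNneq ys => ->; apply: mem_nth.
apply/allpairsPdep; exists (size s - i.+1), (size s - j.+1).
rewrite !mem_iota /back; split; try lia.
by congr third; congr nth; lia.
Qed.

Lemma extend_to (s : seq T) (N : nat) :
  uniq s -> spread s -> size s <= N -> N + m <= v ->
  exists t, [/\ uniq (s ++ t), spread (s ++ t) & size (s ++ t) = N].
Proof.
move=> us hs + hN; move e : (N - size s) => d; elim: d => [|d IH] in s us hs e *.
  by move=> sN; exists [::]; rewrite cats0; split=> //; lia.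
move=> sN; have [|y [_ uy hy]] := extend_avoiding (L := [::]) us hs; first by rewrite /=; lia.
have [|| t [ut ht st]] := IH _ uy hy; rewrite ?size_rcons; try lia.
by exists (y :: t); rewrite -cat_rcons.
Qed.

(* Pairs of two old points are harmless: they leave the window before [x] comes,
   whence the restriction to pairs whose second point is a filler. *)
Lemma extend_fillers (s : seq T) (x : T) (c : nat) :
  uniq s -> spread s -> x \notin s -> size s + c + m + l <= v ->
  exists t, [/\ uniq (s ++ t), spread (s ++ t), x \notin s ++ t, size t = c &
    forall i j, i < j -> size s <= j -> j < size (s ++ t) -> j < i + l ->
      [set nth x0 (s ++ t) i; nth x0 (s ++ t) j; x] \notin B].
Proof.
move=> us hs xs; elim: c => [|c IH] hc.
  by exists [::]; rewrite cats0; split=> // i j _ h1 h2; lia.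
have [|t [ut ht xt st hx]] := IH; first lia.
set w := s ++ t in ut ht xt hx *.
have sw : size w = size s + c by rewrite size_cat st.
(* The filler must differ from [x] and complete no block with [x] and one of the last $l-1$ entries:
   [l] exclusions, the summand [l] in the bound. *)
pose L := x :: [seq third B (nth x0 w (size w - i.+1)) x | i <- iota 0 l.-1].
have [|y [yL uy hy]] := extend_avoiding (L := L) ut ht.
  by rewrite /= size_map size_iota sw; lia.
move: yL; rewrite inE negb_or => /andP[yx yL].
exists (rcons t y); rewrite -rcons_cat -/w size_rcons st; split=> //.
  by rewrite mem_rcons inE negb_or eq_sym yx.
move=> i j ij sj; rewrite size_rcons ltnS leq_eqVlt => /orP[/eqP ej|jw] jl; last first.
  by rewrite !nth_rcons jw ifT; [apply: hx | lia].
have iw : i < size w by lia.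
rewrite !nth_rcons ej ltnn eqxx iw; apply: contra yL => hb.
apply/mapP; exists (size w - i.+1); first by rewrite mem_iota; lia.
have -> : size w - (size w - i.+1).+1 = i by lia.
have yw : y \notin w by move: uy; rewrite rcons_uniq => /andP[].
apply/esym/(thirdP hB) => //.
- by apply: contraNneq xt => <-; apply: mem_nth.
- by apply: contraNneq yw => ->; apply: mem_nth.
- by rewrite setUAC.
Qed.

Lemma extend_to_point (s : seq T) (x : T) :
  uniq s -> spread s -> size s + l.-1 + m + l <= v ->
  exists t, [/\ uniq (s ++ t), spread (s ++ t), x \in s ++ t & size t <= l.-1].
Proof.
move=> us hs hv; have [xs|xs] := boolP (x \in s).
  by exists [::]; rewrite cats0.
have [|t [ut ht xt st hx]] := extend_fillers (c := l.-2) us hs xs; first lia.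
exists (rcons t x); rewrite -rcons_cat rcons_uniq xt ut mem_rcons mem_head size_rcons st.
split=> //; last lia.
have sw : size (s ++ t) = size s + l.-2 by rewrite size_cat st.
(* After $l-2$ fillers at most the last entry of [s] is still within reach of [x], so the second
   point of each pair is a filler. *)
by apply: spread_rcons => // i j ij js il; apply: hx => //; lia.
Qed.

Lemma extend_to_points (D s : seq T) :
  uniq s -> spread s -> size s + size D * l.-1 + m + l <= v ->
  exists t, [/\ uniq (s ++ t), spread (s ++ t), {subset D <= s ++ t} &
    size t <= size D * l.-1].
Proof.
elim: D s => [|x D IH] s us hs; rewrite /= ?mulSn => hv.
  by exists [::]; rewrite cats0.
have [|t [ut ht xt st]] := extend_to_point x us hs; first nia.
have [|t' [ut' ht' Dt st']] := IH _ ut ht; first by rewrite size_cat; nia.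
exists (t ++ t'); rewrite catA; split=> //; last by rewrite size_cat; nia.
move=> y; rewrite inE => /orP[/eqP->|/Dt //]; by rewrite mem_cat xt.
Qed.

End Build.

(** * From positions back to windows *)

(** The points of a block inside a window occupy distinct positions less than [l] apart; each of
    their six possible orders contradicts [spread]. *)
Lemma spread_good (l v : nat) (T : finType) (B : {set {set T}}) (x0 : T) (s : seq T) :
  steiner_triple_system v B -> uniq s -> size s = v -> spread l B x0 s ->
  good_sequencing l B s.
Proof.
move=> [cT c3 _] us ss hs; split.
  have sub : {subset s <= enum T} by move=> x _; rewrite mem_enum.
  have [|_ e] := uniq_min_size us sub; first by rewrite -cardE cT ss.
  by apply: uniq_perm => //; exact: enum_uniq.
move=> j jl b bB; apply/negP => /subsetP bw.
have key x : x \in b -> exists2 p, j <= p < j + l & nth x0 s p = x.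
  move=> /bw; rewrite /window => /(nthP x0)[q]; rewrite size_take size_drop => hq <-.
  have ql : q < l by move: hq; case: ifP; lia.
  by exists (j + q); [lia | rewrite nth_take // nth_drop].
have [x [y [z [xy xz yz eb]]]] : exists x y z, [/\ x != y, x != z, y != z & b = [set x; y; z]].
  have := enum_uniq b; have := c3 _ bB; rewrite cardE.
  have eb x : (x \in b) = (x \in enum b) by rewrite mem_enum.
  case: (enum b) eb => [|x [|y [|z []]]] //= eb _.
  rewrite !inE !negb_or !andbT => /andP[/andP[xy xz] yz].
  by exists x, y, z; split=> //; apply/setP => t; rewrite eb !inE orbA.
have [p hp ep] : exists2 p, j <= p < j + l & nth x0 s p = x by apply: key; rewrite eb !inE eqxx.
have [q hq eq] : exists2 p, j <= p < j + l & nth x0 s p = y by apply: key; rewrite eb !inE eqxx ?orbT.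
have [r hr er] : exists2 p, j <= p < j + l & nth x0 s p = z by apply: key; rewrite eb !inE eqxx ?orbT.
have pq : p != q by apply: contraNneq xy => e; rewrite -ep -eq e.
have pr : p != r by apply: contraNneq xz => e; rewrite -ep -er e.
have qr : q != r by apply: contraNneq yz => e; rewrite -eq -er e.
have H a1 a2 a3 : a1 < a2 -> a2 < a3 -> j <= a1 -> a3 < j + l ->
    [set nth x0 s a1; nth x0 s a2; nth x0 s a3] = b -> False.
  move=> h1 h2 h3 h4 e; move: bB; rewrite -e; apply/negP; apply: hs => //; lia.
have E a1 a2 a3 (f : nat -> T := nth x0 s) : (forall t, (t == f a1) || (t == f a2) || (t == f a3) =
    (t == x) || (t == y) || (t == z)) -> [set f a1; f a2; f a3] = b.
  by move=> e; rewrite eb; apply/setP => t; rewrite !inE.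
have [pq'|pq'|/eqP] := ltngtP p q; last by rewrite (negPf pq).
- have [qr'|qr'|/eqP] := ltngtP q r; last by rewrite (negPf qr).
  + by apply: (H p q r); [lia..|apply: E => t; rewrite ep eq er; do 3![case: eqP => ?]].
  + have [pr'|pr'|/eqP] := ltngtP p r; last by rewrite (negPf pr).
    * by apply: (H p r q); [lia..|apply: E => t; rewrite ep eq er; do 3![case: eqP => ?]].
    * by apply: (H r p q); [lia..|apply: E => t; rewrite ep eq er; do 3![case: eqP => ?]].
- have [qr'|qr'|/eqP] := ltngtP q r; last by rewrite (negPf qr).
  + have [pr'|pr'|/eqP] := ltngtP p r; last by rewrite (negPf pr).
    * by apply: (H q p r); [lia..|apply: E => t; rewrite ep eq er; do 3![case: eqP => ?]].
    * by apply: (H q r p); [lia..|apply: E => t; rewrite ep eq er; do 3![case: eqP => ?]].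
  + by apply: (H r q p); [lia..|apply: E => t; rewrite ep eq er; do 3![case: eqP => ?]].
Qed.

(** * Arithmetic of the insertion positions *)

(* The positions 0, l, ..., (m - 1) l of the m inserted points; [unshift] gives
   the position, before the insertion, of the entry found at [p] afterwards. *)
Definition hole (l m p : nat) : bool := (p < m * l) && (l %| p).

Definition unshift (l m p : nat) : nat := p - minn m (p %/ l).+1.

(** Linear data replacing division: [p] is entry [b] of run [a], where a hole precedes each run of
    $l-1$ old entries, or [p] lies past all these runs. *)
Variant nonhole_spec (l m p : nat) : nat -> Prop :=
| Nonhole_block a b of a < m & b.+1 < l & p = a * l + b.+1 :
    nonhole_spec l m p (a * l.-1 + b)
| Nonhole_tail of m * l <= p : nonhole_spec l m p (p - m).

Lemma unshiftP (l m p : nat) :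
  1 < l -> ~~ hole l m p -> nonhole_spec l m p (unshift l m p).
Proof.
move=> l1; rewrite /hole /unshift; have [pm|mp _] /= := ltnP p (m * l); last first.
  have := leq_div2r l mp; rewrite mulnK; last lia.
  by move=> h; rewrite (minn_idPl _); [apply: Nonhole_tail | lia].
move=> pl.
have am : p %/ l < m by rewrite ltn_divLR //; lia.
have bl : p %% l < l by rewrite ltn_pmod //; lia.
have b0 : 0 < p %% l by rewrite lt0n.
have e := divn_eq p l.
rewrite (minn_idPr _) //.
have ll : p %/ l * l = p %/ l * l.-1 + p %/ l by rewrite -{2}(prednK (ltnW l1)) mulnS addnC.
move: (p %/ l) (p %% l) am bl b0 e ll => a b am bl b0 e ll.
have -> : p - a.+1 = a * l.-1 + b.-1 by rewrite e ll; move: (a * l.-1) => c; lia.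
by apply: Nonhole_block; lia.
Qed.

Lemma unshift_lt (l m p q : nat) :
  1 < l -> ~~ hole l m p -> ~~ hole l m q -> p < q ->
  unshift l m p < unshift l m q <= unshift l m p + (q - p).
Proof.
move=> l1 /(unshiftP l1)[a b am bl ep|mp] /(unshiftP l1)[a' b' am' bl' eq|mq] pq.
- nia.
- nia.
- nia.
- nia.
Qed.

(** Inside one run the old distance is at most $l-2$. Between neighbouring runs a hole separates the
    entries, so the old distance is one less than the new one, again at most $l-2$. *)
Lemma unshift_near (l m p q : nat) :
  1 < l -> ~~ hole l m p -> ~~ hole l m q -> p < q -> q < p + l -> q < m * l ->
  (unshift l m q < unshift l m p + l.-1) && (unshift l m q < m * l.-1).
Proof.
move=> l1 /(unshiftP l1)[a b am bl ep|mp] /(unshiftP l1)[a' b' am' bl' eq|mq] pq pl ql; try lia.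
have aa : a <= a' by nia.
have aa' : a' <= a.+1 by nia.
have h : a'.+1 * l.-1 <= m * l.-1 by rewrite leq_mul2r am' orbT.
apply/andP; split; last by move: h; rewrite mulSn; lia.
move: aa; rewrite leq_eqVlt => /orP[/eqP ea|aa]; first by rewrite -ea; lia.
have ea : a' = a.+1 by lia.
rewrite ea mulSn; move: eq ep; rewrite ea mulSn; lia.
Qed.

Lemma unshift_bound (l m q n : nat) :
  1 < l -> ~~ hole l m q -> q < n + m -> m * l.-1 <= n -> unshift l m q < n.
Proof.
move=> l1 /(unshiftP l1)[a b am bl _|mq] qn mn.
  by have : a.+1 * l.-1 <= m * l.-1; [rewrite leq_mul2r am orbT | rewrite mulSn; lia].
have : m <= m * l by rewrite leq_pmulr //; lia.
lia.
Qed.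

Lemma hole_far (l m h h' : nat) : hole l m h -> hole l m h' -> h < h' -> h + l <= h'.
Proof.
move=> /andP[_ dh] /andP[_ dh'] hh.
have : l <= h' - h by apply: dvdn_leq; [lia | rewrite dvdn_sub].
lia.
Qed.

(** A full run follows every hole, so entries less than [l] past a hole are still in the range of
    [unshift_near]. *)
Lemma hole_end (l m h : nat) : hole l m h -> h + l <= m * l.
Proof.
move=> /andP[hm /dvdnP[k ek]]; move: hm; rewrite ek ltn_mul2r => /andP[_ km].
by rewrite addnC -mulSn leq_mul2r km orbT.
Qed.

(** * Merging the left-over points into the sequence *)

Section Merge.
Context (l : nat) (T : finType) (B : {set {set T}}) (x0 : T) (W R : seq T).
Hypotheses (l1 : 1 < l) (spreadW : spread l B x0 W) (uniqRW : uniq (R ++ W)).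
Local Notation m := (size R).
Hypotheses (longW : m * l.-1 <= size W).
Hypothesis apartR : forall i j z, i < j -> j < i + l.-1 -> j < m * l.-1 -> z \in R ->
  [set nth x0 W i; nth x0 W j; z] \notin B.

Definition merge_at (p : nat) : T :=
  if hole l m p then nth x0 R (p %/ l) else nth x0 W (unshift l m p).

Lemma mem_merge_hole p : hole l m p -> merge_at p \in R.
Proof.
move=> hp; rewrite /merge_at hp mem_nth // ltn_divLR; last lia.
by case/andP: hp.
Qed.

Lemma merge_at_neq p q : p < q -> q < size W + m -> merge_at p != merge_at q.
Proof.
move=> pq qN.
move: (uniqRW); rewrite cat_uniq => /and3P[uR /hasPn dRW uW].
have RW x y : x \in R -> y \in W -> x != y.
  by move=> xR yW; apply: contraTneq xR => ->; apply: dRW.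
have inW r : r < size W + m -> ~~ hole l m r -> merge_at r \in W.
  by move=> rN hr; rewrite /merge_at (negPf hr) mem_nth // unshift_bound.
have [hp|hp] := boolP (hole l m p); have [hq|hq] := boolP (hole l m q).
- have l0 : 0 < l by lia.
  have := hole_far hp hq pq => pql.
  have ltm r : hole l m r -> r %/ l < m by move=> /andP[rm _]; rewrite ltn_divLR.
  rewrite /merge_at hp hq nth_uniq ?ltm //.
  have := leq_div2r l pql; rewrite divnDr // divnn l0.
  by move=> h; apply/eqP; lia.
- by apply: RW; [apply: mem_merge_hole | apply: inW].
- by rewrite eq_sym; apply: RW; [apply: mem_merge_hole | apply: inW => //; apply: ltn_trans qN].
- rewrite /merge_at (negPf hp) (negPf hq).
  have /andP[h _] := unshift_lt l1 hp hq pq.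
  have hb := unshift_bound l1 hq qN longW.
  by rewrite nth_uniq // ?(ltn_eqF h) // (ltn_trans h).
Qed.

(** At most one of the three positions is a hole. With one, the other two entries are a close pair
    early in [W], handled by [apartR]; with none, the triple pulls back to a window of [W]. *)
Lemma merge_spread : spread l B x0 (mkseq merge_at (size W + m)).
Proof.
move=> i j k ij jk; rewrite size_mkseq => kN kl.
rewrite !nth_mkseq; try lia.
have near p q z : ~~ hole l m p -> ~~ hole l m q -> p < q -> q < p + l -> q < m * l ->
    z \in R -> [set merge_at p; merge_at q; z] \notin B.
  move=> hp hq pq ql qm zR; rewrite /merge_at (negPf hp) (negPf hq).
  by have /andP[h1 h2] := unshift_near l1 hp hq pq ql qm; apply: apartR => //;
     case/andP: (unshift_lt l1 hp hq pq).
have far p q : p < q -> q < p + l -> hole l m p -> ~~ hole l m q.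
  by move=> pq ql hp; apply/negP => hq; have := hole_far hp hq pq; lia.
have far' p q : p < q -> q < p + l -> hole l m q -> ~~ hole l m p.
  by move=> pq ql hp; apply/negP => hq; have := hole_far hq hp pq; lia.
have [hi|hi] := boolP (hole l m i).
  have e := hole_end hi.
  (* Reordering puts the inserted point last, as in [near]. *)
  rewrite -setUA setUC; apply: near; try lia; try (apply: (far i) => //; lia).
  exact: mem_merge_hole.
have [hj|hj] := boolP (hole l m j).
  have e := hole_end hj.
  rewrite setUAC; apply: near => //; try lia; try (apply: (far j) => //; lia).
  exact: mem_merge_hole.
have [hk|hk] := boolP (hole l m k).
  have e := hole_end hk.
  apply: near => //; try lia.
  exact: mem_merge_hole.
rewrite /merge_at (negPf hi) (negPf hj) (negPf hk).
have /andP[h1 h1'] := unshift_lt l1 hi hj ij.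
have /andP[h2 h2'] := unshift_lt l1 hj hk jk.
apply: spreadW => //; first exact: unshift_bound.
lia.
Qed.

Lemma merge_uniq : uniq (mkseq merge_at (size W + m)).
Proof.
apply/(uniqP x0) => p q; rewrite !inE size_mkseq => pN qN.
rewrite !nth_mkseq // => e; have [pq|pq|//] := ltngtP p q.
- by have := merge_at_neq pq qN; rewrite e eqxx.
- by have := merge_at_neq pq pN; rewrite e eqxx.
Qed.

End Merge.

(** * The bound on [v] and the assembly *)

(** The summands are [n] points for the beginning, $l-1$ for each of its at most $n(l-2)$ close
    pairs, [m] left for insertion, and [l] spare for choosing fillers. *)
Lemma points_enough (l v : nat) (m := 'C(l.-1, 2)) (n := m * l.-1) :
  3 <= l ->
  ((l%:R - 1) *
     (l%:R ^+ 5 - 9 * l%:R ^+ 3 + 20 * l%:R ^+ 2 - 36 * l%:R + 16) / 16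
   <= v%:R :> rat)%R ->
  n + n * l.-2 * l.-1 + m + l <= v.
Proof.
move=> hl hv; rewrite -(ler_nat rat); apply: le_trans hv.
have m2 : m * 2 = l.-1 * l.-2 by rewrite -[2]/(2`!) bin_ffact ffactnS ffactn1.
have [k ek] : exists k, l = k.+3 by exists (l - 3); lia.
rewrite /n; clearbody m; move: m2; rewrite ek /= -[k.+3]addn3 -[k.+2]addn2 -[k.+1]addn1 => m2.
have mR : (m%:R = (k%:R + 2) * (k%:R + 1) / 2 :> rat)%R.
  have := congr1 (fun t => t%:R : rat)%R m2; rewrite !natrM !natrD; lra.
rewrite !(natrD, natrM) mR.
have : (0 <= k%:R :> rat)%R by apply: ler0n.
move: (k%:R)%R => x x0.
(* In $x = l-3$ the difference of the two sides has only nonnegative coefficients. *)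
have := exprn_ge0 2 x0; have := exprn_ge0 3 x0; have := exprn_ge0 4 x0.
have := exprn_ge0 5 x0; have := exprn_ge0 6 x0.
lra.
Qed.

Theorem theorem3p6 (l v : nat) (T : finType) (B : {set {set T}})
    (hl : 3 <= l)
    (hB : steiner_triple_system v B)
    (hv : ((l%:R - 1) *
             (l%:R ^+ 5 - 9 * l%:R ^+ 3 + 20 * l%:R ^+ 2 - 36 * l%:R + 16) / 16
           <= v%:R :> rat)%R) :
  exists s : seq T, good_sequencing l B s.
Proof.
have cT : #|T| = v by case: hB.
have := points_enough hl hv; set m := 'C(_, _); set n := m * _; set q := n * l.-2 * l.-1 => hn.
have [x0 _] : exists x0 : T, x0 \notin [::] by apply: exists_notin; rewrite cT /=; lia.
have sp0 : spread l B x0 [::] by [].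
have [||W0 /= [u0 s0 z0]] := extend_to (N := n) hl hB (s := [::]) isT sp0 => //.
  by rewrite -/m; lia.
(* Pairs running past the end of [W0] read the default [x0]; they merely add harmless points to
   [D]. *)
pose D := [seq third B (nth x0 W0 i) (nth x0 W0 (i + d.+1)) | i <- iota 0 n, d <- iota 0 l.-2].
have zD : size D = n * l.-2 by rewrite size_allpairs !size_iota.
have [|t1 [u1 s1 D1 z1]] := extend_to_points (D := D) hl hB u0 s0.
  by rewrite zD z0 -/m -/q.
have [||t2 [u2 s2 z2]] := extend_to (N := v - m) hl hB u1 s1.
- by rewrite size_cat z0; move: z1; rewrite zD -/q; lia.
- by rewrite -/m; lia.
set W := (W0 ++ t1) ++ t2 in u2 s2 z2.
pose R := [seq x <- enum T | x \notin W].
have zR : size R = m.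
  have := count_predC (mem W) (enum T); rewrite -cardE cT -[count (mem W) _]size_filter.
  rewrite (@perm_size _ _ W); last first.
    apply: uniq_perm => //; first by rewrite filter_uniq ?enum_uniq.
    by move=> x; rewrite mem_filter mem_enum andbT.
  by rewrite /R size_filter z2 => /(canRL (addKn _)) ->; lia.
have uRW : uniq (R ++ W).
  rewrite cat_uniq u2 filter_uniq ?enum_uniq // andbT /=.
  by apply/hasPn => x xW; rewrite mem_filter xW.
have lW : size R * l.-1 <= size W by rewrite zR z2 -/n; lia.
have aR i j z : i < j -> j < i + l.-1 -> j < size R * l.-1 -> z \in R ->
    [set nth x0 W i; nth x0 W j; z] \notin B.
  rewrite zR -/n mem_filter => ij jl jn /andP[zW _]; apply: contra zW => hb.
  have e a : a < n -> nth x0 W a = nth x0 W0 a.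
    by move=> an; rewrite /W -catA nth_cat z0 an.
  have jW : j < size W by lia.
  have iW : i < size W := ltn_trans ij jW.
  (* If [z] is one of the pair it lies in [W] at once; otherwise it is the pair's third point, hence
     in [D] and again in [W]. *)
  have [zi|zi] := eqVneq z (nth x0 W i); first by rewrite zi mem_nth.
  have [zj|zj] := eqVneq z (nth x0 W j); first by rewrite zj mem_nth.
  rewrite mem_cat; apply/orP; left; apply: D1; apply/allpairsP.
  exists (i, j - i.+1); rewrite !mem_iota /=; split; try lia.
  have -> : i + (j - i.+1).+1 = j by lia.
  rewrite -!e; try lia.
  by apply/esym/(thirdP hB) => //; rewrite nth_uniq // (ltn_eqF ij).
exists (mkseq (merge_at l x0 W R) (size W + size R)).
apply: (spread_good (x0 := x0) hB).
- by apply: merge_uniq => //; lia.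
- by rewrite size_mkseq zR z2; lia.
- by apply: merge_spread => //; lia.
Qed.
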